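(* Let $n\ge3$ and let $\lambda:\Lambda_n\to\mathbb{C}^*$ be the linear part given by $(\lambda_1,\dots,\lambda_n)=(a,1,\dots,1,a^{-1})$ with $a\ne1$. Then the action of $\mathrm{PB}_n\mathbb{D}$ on $\mathrm{PH}_\lambda$ has exactly $n-2$ fixed points, and the other points of $\mathrm{PH}_\lambda$ have a finite orbit if and only if $a$ is a root of unity. More precisely, let $\rho\in\mathrm{Hom}_\lambda(\Lambda_n,\mathrm{Aff}(\mathbb{C}))$ be a representation whose conjugacy class is the point of $\mathrm{PH}_\lambda$ with homogeneous coordinates $[\tau_2:\dots:\tau_{n-1}]\in\mathbb{P}^{n-3}(\mathbb{C})$, and set $k=\mathrm{card}\{i\mid 1<i<n,\ \tau_i\ne0\}$. Then $[\rho]$ is a fixed point if and only if $k=1$, and if $a$ has finite order $\omega$, the orbit of $[\rho]$ has cardinality $\omega^{k-1}$.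
   Context: $\Lambda_n$ is the fundamental group of the Riemann sphere minus $n$ points, $\Lambda_n=\langle\alpha_1,\dots,\alpha_n\mid\alpha_1\cdots\alpha_n=1\rangle$. $\mathrm{Aff}(\mathbb{C})$ is the group of maps $z\mapsto az+b$ of $\mathbb{C}$, $a\in\mathbb{C}^*$, $b\in\mathbb{C}$, under composition. For $\rho\in\mathrm{Hom}(\Lambda_n,\mathrm{Aff}(\mathbb{C}))$ write $\rho(\alpha_i):z\mapsto\lambda_iz+\tau_i$. The homomorphism $\lambda:\Lambda_n\to\mathbb{C}^*$, $\lambda(\alpha_i)=\lambda_i$, identified with $(\lambda_1,\dots,\lambda_n)$ (so $\lambda_1\cdots\lambda_n=1$), is the linear part of $\rho$; $(\tau_1,\dots,\tau_n)$ is its translation part. $\mathrm{Hom}_\lambda(\Lambda_n,\mathrm{Aff}(\mathbb{C}))$ is the set of $\rho$ with linear part $\lambda$, a vector space with coordinates $(\tau_1,\dots,\tau_{n-1})$. Conjugation by $z\mapsto az+b$ replaces $(\tau_i)$ by $(a\tau_i+b(1-\lambda_i))$. For $\lambda$ nontrivial, $\mathrm{H}_\lambda:=\mathrm{Hom}_\lambda(\Lambda_n,\mathrm{Aff}(\mathbb{C}))/\mathbb{C}(1-\lambda_1,\dots,1-\lambda_{n-1})\cong\mathbb{C}^{n-2}$, and $\mathrm{PH}_\lambda\cong\mathbb{P}^{n-3}(\mathbb{C})$ is its projectivization. Its points are the $\mathrm{Aff}(\mathbb{C})$-conjugacy classes $[\rho]$ of those $\rho$ with linear part $\lambda$ that are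 not conjugate to a representation with all $\tau_i=0$. When $\lambda_1\ne1$, each class in $\mathrm{H}_\lambda$ has a unique representative with $\tau_1=0$, and the remaining $(\tau_2,\dots,\tau_{n-1})$ are used as coordinates on $\mathrm{H}_\lambda$ and as homogeneous coordinates on $\mathrm{PH}_\lambda$. The pure braid group $\mathrm{PB}_n\mathbb{D}$ of the disk is generated by the pure braids $\sigma_{i,j}^2$ $(1\le i<j\le n)$. It acts on $\mathrm{Hom}(\Lambda_n,\mathrm{Aff}(\mathbb{C}))$ by $\beta\cdot\rho=\rho\circ\mathrm{Hur}(\beta)$, where $\mathrm{Hur}$ is the antimorphism to $\mathrm{Aut}(\Lambda_n)$ (Hurwitz action) for which $\sigma_{i,j}$ acts by $\alpha_i\mapsto(\alpha_i\cdots\alpha_{j-1})\alpha_j(\alpha_i\cdots\alpha_{j-1})^{-1}$, $\alpha_j\mapsto(\alpha_{i+1}\cdots\alpha_{j-1})^{-1}\alpha_i(\alpha_{i+1}\cdots\alpha_{j-1})$, $\alpha_k\mapsto\alpha_k$ for $k\ne i,j$, and $\sigma_{i,j}^2$ acts by the square of this automorphism. This action preserves linear parts and induces an action on $\mathrm{PH}_\lambda$. *)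

(* Defs.v *)
From HB Require Import structures.
From mathcomp Require Import all_boot all_order all_algebra.
From mathcomp Require Import boolp classical_sets functions cardinality reals.
From mathcomp Require Import complex.
From mathcomp Require Import zify.
Set Implicit Arguments.
Unset Strict Implicit.
Unset Printing Implicit Defensive.

Import GRing.Theory.
Local Open Scope classical_set_scope.
Local Open Scope group_scope.
Local Open Scope quotient_scope.

Local Notation monoid_morphism := monoid.monoid_morphism.

(* The letter (x, false) stands for x and (x, true) for its inverse. *)
Notation word X := (seq (X * bool)).

Section Presented.
Variables (X : choiceType) (rel : word X -> word X -> Prop).

Inductive word_cong : word X -> word X -> Prop :=
| CongRel u v : rel u v -> word_cong u v
| CongCancel x b : word_cong [:: (x, b); (x, ~~ b)] [::]
| CongCat u u' v v' :
    word_cong u u' -> word_cong v v' -> word_cong (u ++ v) (u' ++ v')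
| CongRefl u : word_cong u u
| CongSym u v : word_cong u v -> word_cong v u
| CongTrans u v w : word_cong u v -> word_cong v w -> word_cong u w.

Definition word_congb u v : bool := `[< word_cong u v >].

Fact word_congb_refl : reflexive word_congb.
Proof. by move=> u; apply/asboolP; exact: CongRefl. Qed.

Fact word_congb_sym : symmetric word_congb.
Proof.
by move=> u v; apply/asboolP/asboolP => /CongSym.
Qed.

Fact word_congb_trans : transitive word_congb.
Proof.
move=> v u w /asboolP uv /asboolP vw.
by apply/asboolP; exact: CongTrans uv vw.
Qed.

Canonical word_congb_equiv :=
  EquivRel word_congb word_congb_refl word_congb_sym word_congb_trans.

Definition presented := {eq_quot word_congb}.

HB.instance Definition _ := Choice.on presented.
HB.instance Definition _ := EqQuotient.on presented.

Implicit Types x y z : presented.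

Definition pr_class (u : word X) : presented := \pi_presented u.
Definition pr_word x : word X := repr x.

Lemma pr_wordK : cancel pr_word pr_class.
Proof. exact: reprK. Qed.

Lemma pr_classP u v : pr_class u = pr_class v <-> word_cong u v.
Proof.
split=> [/eqquotP/asboolP //|uv].
by apply/eqquotP/asboolP.
Qed.

Lemma pr_classK u : word_cong (pr_word (pr_class u)) u.
Proof. by apply/pr_classP; rewrite pr_wordK. Qed.

Definition winv (u : word X) : word X := rev [seq (p.1, ~~ p.2) | p <- u].

Definition pr_one : presented := pr_class [::].
Definition pr_mul x y : presented := pr_class (pr_word x ++ pr_word y).
Definition pr_inv x : presented := pr_class (winv (pr_word x)).

Lemma winvK : involutive winv.
Proof.
move=> u; rewrite /winv map_rev revK -map_comp -[RHS]map_id.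
by apply: eq_map => -[x b] /=; rewrite negbK.
Qed.

Lemma winv_congl u : word_cong (winv u ++ u) [::].
Proof.
elim: u => [|[x b] u IHu]; first exact: CongRefl.
rewrite /winv /= rev_cons -cats1 -catA /=.
apply: CongTrans IHu.
apply: CongCat; first exact: CongRefl.
apply: (@CongCat [:: (x, ~~ b); (x, b)] [::] u u); last exact: CongRefl.
by case: b; [exact: (CongCancel x false)|exact: (CongCancel x true)].
Qed.

Lemma pr_classM u v : pr_mul (pr_class u) (pr_class v) = pr_class (u ++ v).
Proof. by apply/pr_classP; apply: CongCat; exact: pr_classK. Qed.

Fact pr_mulA : associative pr_mul.
Proof.
by move=> x y z; rewrite -[x]pr_wordK -[y]pr_wordK -[z]pr_wordK !pr_classM catA.
Qed.

Fact pr_mul1 : left_id pr_one pr_mul.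
Proof. by move=> x; rewrite -[x]pr_wordK pr_classM. Qed.

Fact pr_1mul : right_id pr_one pr_mul.
Proof. by move=> x; rewrite -[x]pr_wordK pr_classM cats0. Qed.

Fact pr_mulV : left_inverse pr_one pr_inv pr_mul.
Proof.
move=> x; rewrite -{2}[x]pr_wordK pr_classM.
by apply/pr_classP; exact: winv_congl.
Qed.

Fact pr_Vmul : right_inverse pr_one pr_inv pr_mul.
Proof.
move=> x; rewrite -{1}[x]pr_wordK pr_classM -{1}[pr_word x]winvK.
by apply/pr_classP; exact: winv_congl.
Qed.

HB.instance Definition _ := isGroup.Build presented
  pr_mulA pr_mul1 pr_1mul pr_mulV pr_Vmul.

Definition pgen (a : X) : presented := pr_class [:: (a, false)].

Section Lift.
Variables (G : groupType) (f : X -> G).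

Definition letter_eval (p : X * bool) : G := if p.2 then (f p.1)^-1 else f p.1.
Definition word_eval (w : word X) : G := \prod_(p <- w) letter_eval p.

(* A homomorphism only when f satisfies the relations. *)
Definition plift x : G := word_eval (pr_word x).

Definition satisfies_rel := forall u v, rel u v -> word_eval u = word_eval v.

Hypothesis frel : satisfies_rel.

Lemma word_eval_cong u v : word_cong u v -> word_eval u = word_eval v.
Proof.
elim=> {u v} [u v|x b|u u' v v' _ e1 _ e2|u|u v _ ->|u v w _ -> _ ->] //.
- exact: frel.
- rewrite /word_eval big_cons big_seq1 big_nil /letter_eval /=.
  by case: b; rewrite /= (mulVg, mulgV).
- by rewrite /word_eval !big_cat /= -/(word_eval u) e1 -/(word_eval v) e2.
Qed.

Lemma plift_class u : plift (pr_class u) = word_eval u.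
Proof. by apply: word_eval_cong; exact: pr_classK. Qed.

Lemma plift_gen a : plift (pgen a) = f a.
Proof. by rewrite plift_class /word_eval big_seq1. Qed.

Lemma plift_morphism : monoid_morphism plift.
Proof.
split=> [|x y]; first by rewrite plift_class /word_eval big_nil.
by rewrite -[x]pr_wordK -[y]pr_wordK [_ * _]pr_classM !plift_class
   /word_eval big_cat.
Qed.

End Lift.

Lemma morphV (G H : groupType) (h : G -> H) :
  monoid_morphism h -> {morph h : x / x^-1}.
Proof.
by move=> [h1 hM] x; apply: (@mulgI _ (h x)); rewrite -hM !mulgV h1.
Qed.

Lemma presented_ext (G : groupType) (h h' : presented -> G) :
    monoid_morphism h -> monoid_morphism h' ->
  (forall a, h (pgen a) = h' (pgen a)) -> h = h'.
Proof.
move=> hm hm' e; apply/funext => x; rewrite -[x]pr_wordK.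
elim: (pr_word x) => [|[a b] u IHu]; first by rewrite [LHS]hm.1 [RHS]hm'.1.
rewrite -cat1s -pr_classM [LHS]hm.2 [RHS]hm'.2 IHu; congr (_ * _).
case: b => //; last exact: e.
have -> : pr_class [:: (a, true)] = (pgen a)^-1.
  apply: (@mulgI _ (pgen a)); rewrite mulgV.
  by rewrite [LHS]pr_classM; apply/pr_classP; exact: CongCancel.
by rewrite !morphV // e.
Qed.

End Presented.

Section Aut.
Variable G : groupType.

Definition is_aut (f : G -> G) : Prop := bijective f /\ {morph f : x y / x * y}.

Record aut := MkAut { aut_fun :> G -> G; _ : `[< is_aut aut_fun >] }.

HB.instance Definition _ := [isSub for aut_fun].
HB.instance Definition _ := [Choice of aut by <:].

Implicit Types f g h : aut.

Lemma autP f : is_aut f.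
Proof. by case: f => f /= /asboolP. Qed.

Lemma autM f : {morph f : x y / x * y}.
Proof. exact: (autP f).2. Qed.

Lemma aut_morphism f : monoid_morphism f.
Proof.
by split; [apply: (@mulgI _ (f 1)); rewrite -autM !mulg1|exact: autM].
Qed.

Fact aut_one_subproof : `[< is_aut id >].
Proof. by apply/asboolP; split=> //; exists id. Qed.
Definition aut_one := MkAut aut_one_subproof.

Fact aut_mul_subproof f g : `[< is_aut (f \o g) >].
Proof.
apply/asboolP; split; first by apply: bij_comp; exact: (autP _).1.
by move=> x y /=; rewrite !autM.
Qed.
Definition aut_mul f g := MkAut (aut_mul_subproof f g).

Fact aut_inv_exists f : exists g : G -> G, cancel f g /\ cancel g f.
Proof. by case: (autP f).1 => g fK gK; exists g. Qed.
Definition aut_inv_fun f := projT1 (cid (aut_inv_exists f)).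
Lemma aut_funK f : cancel f (aut_inv_fun f).
Proof. by rewrite /aut_inv_fun; case: cid => g []. Qed.
Lemma aut_inv_funK f : cancel (aut_inv_fun f) f.
Proof. by rewrite /aut_inv_fun; case: cid => g []. Qed.

Fact aut_inv_subproof f : `[< is_aut (aut_inv_fun f) >].
Proof.
apply/asboolP; split; first by exists f; [exact: aut_inv_funK|exact: aut_funK].
move=> x y; apply: (can_inj (aut_funK f)).
by rewrite autM !aut_inv_funK.
Qed.
Definition aut_inv f := MkAut (aut_inv_subproof f).

Lemma aut_eq f g : f =1 g -> f = g.
Proof. by move=> e; apply: val_inj; apply/funext. Qed.

Fact aut_mulA : associative aut_mul.
Proof. by move=> f g h; exact: aut_eq. Qed.
Fact aut_mul1 : left_id aut_one aut_mul.
Proof. by move=> f; exact: aut_eq. Qed.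
Fact aut_1mul : right_id aut_one aut_mul.
Proof. by move=> f; exact: aut_eq. Qed.
Fact aut_mulV : left_inverse aut_one aut_inv aut_mul.
Proof. by move=> f; apply: aut_eq => x /=; exact: aut_funK. Qed.
Fact aut_Vmul : right_inverse aut_one aut_inv aut_mul.
Proof. by move=> f; apply: aut_eq => x /=; exact: aut_inv_funK. Qed.

HB.instance Definition _ := isGroup.Build aut
  aut_mulA aut_mul1 aut_1mul aut_mulV aut_Vmul.

End Aut.

Definition sphere_rel n (u v : word 'I_n) : Prop :=
  u = [seq (i, false) | i <- enum 'I_n] /\ v = [::].

(* The fundamental group of the sphere minus n points,
   < a_0, ..., a_(n-1) | a_0 ... a_(n-1) = 1 >; enum 'I_n is increasing. *)
Definition Lambda n := presented (@sphere_rel n).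
HB.instance Definition _ n := Group.on (Lambda n).

(* Indices start at 0: alpha n i is the (i+1)-st generator for i < n, and it
   is 1 for i >= n. *)
Definition alpha n (i : nat) : Lambda n :=
  if insub i is Some o then pgen _ o else 1.
Arguments alpha : clear implicits.

Definition braid_rel n (u v : word 'I_n.-1) : Prop :=
  exists k l : 'I_n.-1,
    ((k.+1 < l)%N /\ u = [:: (k, false); (l, false)]
                  /\ v = [:: (l, false); (k, false)])
    \/ (k.+1 = l :> nat /\ u = [:: (k, false); (l, false); (k, false)]
                        /\ v = [:: (l, false); (k, false); (l, false)]).

Definition Braid n := presented (@braid_rel n).
HB.instance Definition _ n := Group.on (Braid n).

(* The Artin generator exchanging the strands k and k+1, for k + 1 < n. *)
Definition artin n (k : nat) : Braid n :=
  if insub k is Some o then pgen _ o else 1.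
Arguments artin : clear implicits.

(* sigma n i j is the half-twist of the strands i < j; it is the conjugate of
   artin n i by artin n i.+1 * ... * artin n j.-1. See Hur_sigma below. *)
Definition sigma n (i j : nat) : Braid n :=
  artin n i ^ (\prod_(i.+1 <= k < j) artin n k).
Arguments sigma : clear implicits.

Definition is_subgroup (G : groupType) (H : set G) : Prop :=
  H 1 /\ (forall x y, H x -> H y -> H (x / y)).

Definition pure_generators n : set (Braid n) :=
  [set b | exists i j, (i < j < n)%N /\ b = sigma n i j ^+ 2].

(* The pure braid group, through its classical generators sigma_(i,j)^2 rather
   than as the kernel of the morphism to the symmetric group. *)
Definition PureBraid n : set (Braid n) :=
  smallest (@is_subgroup (Braid n)) (@pure_generators n).
Arguments PureBraid : clear implicits.

Section Hurwitz.
Variable n : nat.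

Lemma alpha_ord (i : 'I_n) : alpha n i = pgen _ i.
Proof. by rewrite /alpha valK. Qed.

Lemma prod_enum_ord (G : groupType) (f : nat -> G) :
  \prod_(i <- enum 'I_n) f i = \prod_(0 <= i < n) f i.
Proof. by rewrite /index_iota subn0 -val_enum_ord [RHS]big_map. Qed.

Lemma word_eval_sphere (G : groupType) (f : nat -> G) (u v : word 'I_n) :
  sphere_rel u v -> word_eval (fun i : 'I_n => f i) u = \prod_(0 <= i < n) f i.
Proof.
by case=> -> _; rewrite /word_eval big_map -prod_enum_ord.
Qed.

Lemma prod_alpha : \prod_(0 <= i < n) alpha n i = 1.
Proof.
have prodE s : \prod_(i <- s) alpha n (i : 'I_n) =
    pr_class (@sphere_rel n) [seq (i, false) | i <- s].
  elim: s => [|i s IHs]; first by rewrite big_nil.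
  by rewrite big_cons IHs alpha_ord [LHS]pr_classM.
by rewrite -prod_enum_ord prodE; apply/pr_classP/CongRel.
Qed.

Lemma Lambda_lift (G : groupType) (f : nat -> G) :
  \prod_(0 <= i < n) f i = 1 ->
  let h := plift (fun i : 'I_n => f i) : Lambda n -> G in
  monoid_morphism h /\ (forall i, (i < n)%N -> h (alpha n i) = f i).
Proof.
move=> f1 h.
have fr : satisfies_rel (@sphere_rel n) (fun i : 'I_n => f i).
  move=> u v uv; rewrite (word_eval_sphere f uv) f1.
  by case: uv => _ ->; rewrite /word_eval big_nil.
split=> [|i ltin]; first exact: plift_morphism.
by rewrite (alpha_ord (Ordinal ltin)) /h plift_gen.
Qed.

Lemma Lambda_ext (G : groupType) (h h' : Lambda n -> G) :
    monoid_morphism h -> monoid_morphism h' ->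
  (forall i, (i < n)%N -> h (alpha n i) = h' (alpha n i)) -> h = h'.
Proof.
by move=> hm hm' e; apply: presented_ext => // i; rewrite -alpha_ord e.
Qed.

Lemma prod_local (G : groupType) (f g : nat -> G) k : (k.+1 < n)%N ->
    (forall i, i != k -> i != k.+1 -> f i = g i) ->
    f k * f k.+1 = g k * g k.+1 ->
  \prod_(0 <= i < n) f i = \prod_(0 <= i < n) g i.
Proof.
move=> ltkn fg fgk; have lek2n : (k.+2 <= n)%N by [].
have lekn : (k <= n)%N by apply: leq_trans lek2n; rewrite -addn2 leq_addr.
rewrite !(big_cat_nat (n := k) (leq0n k) lekn) /=; congr (_ * _).
  by apply: eq_big_nat => i /andP[_ ik]; rewrite fg // ltn_eqF // ltnW.
rewrite ![\prod_(k <= _ < n) _]big_ltn ?(ltnW lek2n) //.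
rewrite ![\prod_(k.+1 <= _ < n) _]big_ltn // !mulgA fgk; congr (_ * _).
by apply: eq_big_nat => i /andP[ki _]; rewrite fg // gtn_eqF // ltnW.
Qed.

Definition hurwitz_img (k i : nat) : Lambda n :=
  if i == k then alpha n k * alpha n k.+1 * (alpha n k)^-1
  else if i == k.+1 then alpha n k else alpha n i.

Definition hurwitz_img_inv (k i : nat) : Lambda n :=
  if i == k then alpha n k.+1
  else if i == k.+1 then (alpha n k.+1)^-1 * alpha n k * alpha n k.+1
  else alpha n i.

Definition hurwitz_fun (k : nat) : Lambda n -> Lambda n :=
  plift (fun i : 'I_n => hurwitz_img k i).

Definition hurwitz_inv_fun (k : nat) : Lambda n -> Lambda n :=
  plift (fun i : 'I_n => hurwitz_img_inv k i).

Lemma succ_eqF k : (k.+1 == k) = false.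
Proof. by rewrite gtn_eqF. Qed.

Lemma hurwitz_funP k : (k.+1 < n)%N -> monoid_morphism (hurwitz_fun k) /\
  (forall i, (i < n)%N -> hurwitz_fun k (alpha n i) = hurwitz_img k i).
Proof.
move=> ltkn; apply: (Lambda_lift (f := hurwitz_img k)).
rewrite -[RHS]prod_alpha; apply: (prod_local ltkn).
- by move=> i /negPf ik /negPf ik1; rewrite /hurwitz_img ik ik1.
- by rewrite /hurwitz_img eqxx succ_eqF eqxx mulgVK.
Qed.

Lemma hurwitz_inv_funP k : (k.+1 < n)%N ->
  monoid_morphism (hurwitz_inv_fun k) /\
  (forall i, (i < n)%N -> hurwitz_inv_fun k (alpha n i) = hurwitz_img_inv k i).
Proof.
move=> ltkn; apply: (Lambda_lift (f := hurwitz_img_inv k)).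
rewrite -[RHS]prod_alpha; apply: (prod_local ltkn).
- by move=> i /negPf ik /negPf ik1; rewrite /hurwitz_img_inv ik ik1.
- by rewrite /hurwitz_img_inv eqxx succ_eqF eqxx !mulgA mulgV mul1g.
Qed.

Lemma morphism_comp (G H K : groupType) (f : H -> K) (g : G -> H) :
  monoid_morphism f -> monoid_morphism g -> monoid_morphism (f \o g).
Proof.
move=> [f1 fM] [g1 gM]; split=> [|x y] /=; first by rewrite g1.
by rewrite gM fM.
Qed.

Lemma hurwitz_funK k : (k.+1 < n)%N ->
  cancel (hurwitz_fun k) (hurwitz_inv_fun k).
Proof.
move=> ltkn.
have ltk : (k < n)%N by exact: ltnW.
have [sm sE] := hurwitz_funP ltkn; have [tm tE] := hurwitz_inv_funP ltkn.
have tV := morphV tm.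
suff e : hurwitz_inv_fun k \o hurwitz_fun k = id.
  by move=> x; rewrite -[RHS](congr1 (fun f => f x) e).
apply: Lambda_ext => //; first exact: morphism_comp.
move=> i ltin /=; rewrite sE // /hurwitz_img; case: eqP => [->|/eqP/negPf ik].
  rewrite !tm.2 tV !tE // /hurwitz_img_inv eqxx succ_eqF eqxx.
  by rewrite !mulgA mulgV mul1g mulgK.
case: eqP => [->|/eqP/negPf ik1]; rewrite tE // /hurwitz_img_inv ?eqxx //.
by rewrite ik ik1.
Qed.

Lemma hurwitz_inv_funK k : (k.+1 < n)%N ->
  cancel (hurwitz_inv_fun k) (hurwitz_fun k).
Proof.
move=> ltkn.
have ltk : (k < n)%N by exact: ltnW.
have [sm sE] := hurwitz_funP ltkn; have [tm tE] := hurwitz_inv_funP ltkn.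
have sV := morphV sm.
suff e : hurwitz_fun k \o hurwitz_inv_fun k = id.
  by move=> x; rewrite -[RHS](congr1 (fun f => f x) e).
apply: Lambda_ext => //; first exact: morphism_comp.
move=> i ltin /=; rewrite tE // /hurwitz_img_inv.
case: eqP => [->|/eqP/negPf ik].
  by rewrite sE // /hurwitz_img succ_eqF eqxx.
case: eqP => [->|/eqP/negPf ik1].
  rewrite !sm.2 sV !sE // /hurwitz_img eqxx succ_eqF eqxx.
  by rewrite !mulgA mulVg mul1g mulgVK.
by rewrite sE // /hurwitz_img ik ik1.
Qed.

Lemma ltn_pred_succ (k : 'I_n.-1) : (k.+1 < n)%N.
Proof. by case: k => k /=; case: (n). Qed.

Fact hurwitz_subproof (k : 'I_n.-1) : `[< is_aut (hurwitz_fun k) >].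
Proof.
apply/asboolP; split.
  exists (hurwitz_inv_fun k); first exact: hurwitz_funK (ltn_pred_succ k).
  exact: hurwitz_inv_funK (ltn_pred_succ k).
exact: (hurwitz_funP (ltn_pred_succ k)).1.2.
Qed.

Definition hurwitz (k : 'I_n.-1) : aut (Lambda n) := MkAut (hurwitz_subproof k).

(* The antimorphism sending each Artin generator k to hurwitz k: it is the
   inverse of the morphism sending k to (hurwitz k)^-1. *)
Definition Hur (b : Braid n) : aut (Lambda n) :=
  (plift (fun k => (hurwitz k)^-1) b)^-1.

Lemma hurwitzE (k : 'I_n.-1) i : (i < n)%N ->
  hurwitz k (alpha n i) = hurwitz_img k i.
Proof. exact: (hurwitz_funP (ltn_pred_succ k)).2. Qed.

Lemma aut_Lambda_eq (f g : aut (Lambda n)) :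
  (forall i, (i < n)%N -> f (alpha n i) = g (alpha n i)) -> f = g.
Proof.
move=> e; apply: val_inj; apply: Lambda_ext => //; exact: aut_morphism.
Qed.

Lemma alpha_geq i : (n <= i)%N -> alpha n i = 1.
Proof. by move=> leni; rewrite /alpha insubF // ltnNge leni. Qed.

Lemma hurwitz_l (k : 'I_n.-1) :
  hurwitz k (alpha n k) = alpha n k * alpha n k.+1 * (alpha n k)^-1.
Proof.
by rewrite hurwitzE ?(ltnW (ltn_pred_succ k)) // /hurwitz_img eqxx.
Qed.

Lemma hurwitz_r (k : 'I_n.-1) : hurwitz k (alpha n k.+1) = alpha n k.
Proof.
by rewrite hurwitzE ?ltn_pred_succ // /hurwitz_img succ_eqF eqxx.
Qed.

Lemma hurwitz_id (k : 'I_n.-1) (i : nat) : i != k -> i != k.+1 ->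
  hurwitz k (alpha n i) = alpha n i.
Proof.
move=> /negPf ik /negPf ik1; have [ltin|leni] := ltnP i n.
  by rewrite hurwitzE // /hurwitz_img ik ik1.
by rewrite alpha_geq // (aut_morphism _).1.
Qed.

Lemma autV (G : groupType) (f : aut G) : {morph f : x / x^-1}.
Proof. exact: morphV (aut_morphism f). Qed.

Lemma aut_mulE (G : groupType) (f g : aut G) x : (f * g) x = f (g x).
Proof. by []. Qed.

Lemma hurwitz_far (k l : 'I_n.-1) : (k.+1 < l)%N ->
  hurwitz k * hurwitz l = hurwitz l * hurwitz k.
Proof.
move=> kl; apply: aut_Lambda_eq => i ltin; rewrite !aut_mulE.
have [->|ik] := eqVneq i k.
  rewrite hurwitz_l (@hurwitz_id l k) ?hurwitz_l; try lia.
  by rewrite !autM autV !(@hurwitz_id l) //; lia.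
have [->|ik1] := eqVneq i k.+1.
  by rewrite hurwitz_r (@hurwitz_id l) ?hurwitz_r ?(@hurwitz_id l) //; lia.
rewrite (@hurwitz_id k i) //.
have [->|il] := eqVneq i l.
  by rewrite hurwitz_l !autM autV !(@hurwitz_id k) //; lia.
have [->|il1] := eqVneq i l.+1.
  by rewrite hurwitz_r !(@hurwitz_id k) //; lia.
by rewrite !(@hurwitz_id l) // hurwitz_id.
Qed.

Lemma hurwitz_braid (k l : 'I_n.-1) : k.+1 = l :> nat ->
  hurwitz k * hurwitz l * hurwitz k = hurwitz l * hurwitz k * hurwitz l.
Proof.
move=> kl; apply: aut_Lambda_eq => i ltin; rewrite !aut_mulE.
have hkl := hurwitz_r k; have hlk := hurwitz_l k; rewrite kl in hkl hlk.
have lk : hurwitz l (alpha n k) = alpha n k by apply: hurwitz_id; lia.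
have kl1 : hurwitz k (alpha n l.+1) = alpha n l.+1 by apply: hurwitz_id; lia.
have [->|ik] := eqVneq i k.
  rewrite lk hlk !(autM (hurwitz l)) (autV (hurwitz l)) lk hurwitz_l.
  rewrite !(autM (hurwitz k)) !(autV (hurwitz k)) hlk hkl kl1.
  by rewrite !invgM invgK !mulgA !mulgVK.
have [->|il] := eqVneq i l.
  rewrite hkl lk hlk hurwitz_l !(autM (hurwitz k)) (autV (hurwitz k)) hkl kl1.
  by rewrite !(autM (hurwitz l)) (autV (hurwitz l)) lk hurwitz_r.
have [->|il1] := eqVneq i l.+1.
  by rewrite kl1 !hurwitz_r hkl lk.
have ik1 : i != k.+1 by rewrite kl.
by rewrite !(hurwitz_id ik ik1, hurwitz_id il il1).
Qed.

Lemma hurwitz_rel :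
  satisfies_rel (@braid_rel n) (fun k => (hurwitz k)^-1).
Proof.
move=> _ _ [k] [l] [[kl [-> ->]]|[kl [-> ->]]];
  rewrite /word_eval !big_cons big_nil /letter_eval /= !mulg1 -!invgM.
  by rewrite (hurwitz_far kl).
by rewrite (hurwitz_braid kl).
Qed.

Lemma Hur1 : Hur 1 = 1.
Proof. by rewrite /Hur (plift_morphism hurwitz_rel).1 invg1. Qed.

Lemma HurM (b c : Braid n) : Hur (b * c) = Hur c * Hur b.
Proof. by rewrite /Hur (plift_morphism hurwitz_rel).2 invgM. Qed.

Lemma HurV (b : Braid n) : Hur b^-1 = (Hur b)^-1.
Proof. by rewrite /Hur (morphV (plift_morphism hurwitz_rel)). Qed.

Lemma HurJ (b c : Braid n) : Hur (b ^ c) = Hur c * Hur b * (Hur c)^-1.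
Proof. by rewrite conjgE !HurM HurV. Qed.

Lemma Hur_artin (k : 'I_n.-1) : Hur (artin n k) = hurwitz k.
Proof. by rewrite /Hur /artin valK plift_gen ?invgK //; exact: hurwitz_rel. Qed.

Lemma sigma_recr i j : (i < j)%N -> sigma n i j.+1 = sigma n i j ^ artin n j.
Proof. by move=> ij; rewrite /sigma big_nat_recr //= conjgM. Qed.

Lemma Hur_sigma i j : (i < j < n)%N ->
  [/\ Hur (sigma n i j) (alpha n i) =
        (\prod_(i <= k < j) alpha n k) * alpha n j *
        (\prod_(i <= k < j) alpha n k)^-1,
      Hur (sigma n i j) (alpha n j) =
        (\prod_(i.+1 <= k < j) alpha n k)^-1 * alpha n i *
        \prod_(i.+1 <= k < j) alpha n k
    & forall k : nat, k != i -> k != j ->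
        Hur (sigma n i j) (alpha n k) = alpha n k].
Proof.
elim: j => // j IHj /andP[]; rewrite ltnS leq_eqVlt => /orP[/eqP <-|ij] ltjn.
  have ltin : (i < n.-1)%N by lia.
  rewrite /sigma ![\prod_(i.+1 <= _ < i.+1) _]big_geq // conjg1 big_nat1.
  rewrite invg1 mul1g mulg1.
  rewrite -[i in artin n i]/(val (Ordinal ltin)) Hur_artin.
  split; first exact: (hurwitz_l (Ordinal ltin)).
    exact: (hurwitz_r (Ordinal ltin)).
  by move=> k; exact: (@hurwitz_id (Ordinal ltin)).
have [|Hi Hj Hk] := IHj; first by rewrite ij ltnW.
have ltj : (j < n.-1)%N by lia.
pose J := Ordinal ltj; have JE : (J : nat) = j by [].
have HJl := hurwitz_l J; have HJr := hurwitz_r J; have HJ := @hurwitz_id J.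
rewrite JE in HJl HJr HJ.
have Hx x : Hur (sigma n i j.+1) x =
    hurwitz J (Hur (sigma n i j) ((hurwitz J)^-1 x)).
  by rewrite sigma_recr // HurJ (Hur_artin J : Hur (artin n j) = _).
have Vl : (hurwitz J)^-1 (alpha n j) = alpha n j.+1.
  by rewrite -HJr; exact: aut_funK.
have Vr : (hurwitz J)^-1 (alpha n j.+1) =
    (alpha n j.+1)^-1 * alpha n j * alpha n j.+1.
  apply: (can_inj (aut_funK (hurwitz J))).
  rewrite [LHS]aut_inv_funK !autM autV HJl HJr.
  by rewrite !mulgA mulVg mul1g mulgVK.
have Vk (k : nat) : k != j -> k != j.+1 -> (hurwitz J)^-1 (alpha n k) = alpha n k.
  by move=> kj kj1; rewrite -{1}(HJ k kj kj1); exact: aut_funK.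
have HJprod a : hurwitz J (\prod_(a <= k < j) alpha n k) =
    \prod_(a <= k < j) alpha n k.
  rewrite (big_morph _ (aut_morphism (hurwitz J)).2
    (aut_morphism (hurwitz J)).1).
  by apply: eq_big_nat => k kj; apply: HJ; lia.
have prodS a : (a <= j)%N ->
    \prod_(a <= k < j.+1) alpha n k = (\prod_(a <= k < j) alpha n k) * alpha n j.
  by move=> aj; rewrite big_nat_recr.
have HJi : hurwitz J (alpha n i) = alpha n i by apply: HJ; lia.
split.
- rewrite Hx Vk; [|lia|lia].
  rewrite Hi !(autM (hurwitz J)) (autV (hurwitz J)) HJprod HJl.
  rewrite prodS; last exact: ltnW.
  rewrite invgM.
  by rewrite !mulgA.
- rewrite Hx Vr !autM autV Hj Hk; [|lia|lia].
  rewrite !autM !autV !HJprod HJr HJi prodS; last exact: ij.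
  rewrite !invgM.
  by rewrite !mulgA.
- move=> k ki kj1; rewrite Hx.
  have [->|kj] := eqVneq k j; first by rewrite Vl Hk ?HJr //; lia.
  by rewrite Vk // Hk // HJ.
Qed.

End Hurwitz.

Section Aff.
Variable F : fieldType.
Local Open Scope ring_scope.

(* The pair (a, b) with a != 0 stands for the map z |-> a z + b. *)
Record aff := Aff { aff_val : F * F; _ : aff_val.1 != 0 }.

HB.instance Definition _ := [isSub for aff_val].
HB.instance Definition _ := [Choice of aff by <:].

Implicit Types f g h : aff.

Definition aff_lin f : F := (aff_val f).1.
Definition aff_tr f : F := (aff_val f).2.
Definition aff_map f (z : F) : F := aff_lin f * z + aff_tr f.

Lemma aff_lin_neq0 f : aff_lin f != 0.
Proof. by case: f. Qed.

Lemma aff_eq f g : aff_lin f = aff_lin g -> aff_tr f = aff_tr g -> f = g.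
Proof.
move=> el et; apply: val_inj; rewrite /= [aff_val f]surjective_pairing.
by rewrite [aff_val g]surjective_pairing; congr (_, _).
Qed.

Fact aff_one_subproof : (1 : F, 0 : F).1 != 0.
Proof. exact: oner_neq0. Qed.
Definition aff_one := Aff aff_one_subproof.

Fact aff_mul_subproof f g :
  (aff_lin f * aff_lin g, aff_lin f * aff_tr g + aff_tr f).1 != 0.
Proof. by rewrite mulf_neq0 ?aff_lin_neq0. Qed.
Definition aff_mul f g := Aff (aff_mul_subproof f g).

Fact aff_inv_subproof f :
  ((aff_lin f)^-1, - ((aff_lin f)^-1 * aff_tr f)).1 != 0.
Proof. by rewrite invr_neq0 ?aff_lin_neq0. Qed.
Definition aff_inv f := Aff (aff_inv_subproof f).

Fact aff_mulA : associative aff_mul.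
Proof.
move=> f g h; apply: aff_eq; rewrite /aff_lin /aff_tr /= ?mulrA //.
by rewrite /aff_lin /aff_tr /= mulrDr mulrA addrA.
Qed.
Fact aff_mul1 : left_id aff_one aff_mul.
Proof.
by move=> f; apply: aff_eq; rewrite /aff_lin /aff_tr /= ?mul1r ?addr0.
Qed.
Fact aff_1mul : right_id aff_one aff_mul.
Proof.
by move=> f; apply: aff_eq; rewrite /aff_lin /aff_tr /= ?mulr1 ?mulr0 ?add0r.
Qed.
Fact aff_mulV : left_inverse aff_one aff_inv aff_mul.
Proof.
move=> f; apply: aff_eq; first by rewrite /aff_lin /= mulVf // aff_lin_neq0.
by rewrite /aff_lin /aff_tr /= /aff_tr subrr.
Qed.
Fact aff_Vmul : right_inverse aff_one aff_inv aff_mul.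
Proof.
move=> f; apply: aff_eq; first by rewrite /aff_lin /= mulfV // aff_lin_neq0.
by rewrite {1}/aff_tr /= {2}/aff_tr /= mulrN mulrA mulfV ?aff_lin_neq0 // mul1r
   addNr.
Qed.

HB.instance Definition _ := isGroup.Build aff
  aff_mulA aff_mul1 aff_1mul aff_mulV aff_Vmul.

Lemma aff_map_inj f g : aff_map f =1 aff_map g -> f = g.
Proof.
move=> e; have := e 0; rewrite /aff_map !mulr0 !add0r => et.
by apply: aff_eq => //; have := e 1; rewrite /aff_map !mulr1 et => /addIr.
Qed.

Lemma aff_mapM f g : aff_map (f * g)%g = aff_map f \o aff_map g.
Proof.
by apply/funext => z; rewrite /aff_map /aff_lin /aff_tr /= mulrDr mulrA addrA.
Qed.

End Aff.

Section Rep.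
Variables (F : fieldType) (n : nat).

Definition Hom_aff : set (Lambda n -> aff F) := [set rho | monoid_morphism rho].

Definition Hom_lin (lam : 'I_n -> F) : set (Lambda n -> aff F) :=
  [set rho | Hom_aff rho /\ forall i : 'I_n, aff_lin (rho (alpha n i)) = lam i].

Definition conj_class (rho : Lambda n -> aff F) : set (Lambda n -> aff F) :=
  range (fun g x => g * rho x * g^-1).

Definition no_translation (rho : Lambda n -> aff F) : Prop :=
  forall i : 'I_n, aff_tr (rho (alpha n i)) = 0%R.

(* PH lam is the set of the conjugacy classes of the representations with
   linear part lam not conjugate to a linear one, that is, the projectivization
   of the quotient of Hom_lin lam by the line spanned by (1 - lam i)_i. *)
Definition PH (lam : 'I_n -> F) : set (set (Lambda n -> aff F)) :=
  conj_class @` [set rho | Hom_lin lam rho /\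
                   ~ (exists2 rho', conj_class rho rho' & no_translation rho')].

(* On conjugacy classes this is the action b . [rho] = [rho \o Hur b], by
   braid_act_class below. *)
Definition braid_act (b : Braid n) (X : set (Lambda n -> aff F)) :
    set (Lambda n -> aff F) :=
  [set rho \o Hur b | rho in X].

Lemma braid_act_class (b : Braid n) (rho : Lambda n -> aff F) :
  braid_act b (conj_class rho) = conj_class (rho \o Hur b).
Proof.
apply/seteqP; split=> [_ [_ [g _ <-] <-]|_ [g _ <-]]; first by exists g.
by exists (fun x => g * rho x * g^-1) => //; exists g.
Qed.

Definition pb_fixed (X : set (Lambda n -> aff F)) : Prop :=
  forall b, PureBraid n b -> braid_act b X = X.

Definition pb_orbit (X : set (Lambda n -> aff F)) :
    set (set (Lambda n -> aff F)) :=
  [set braid_act b X | b in PureBraid n].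

(* The homogeneous coordinates (tau_2, ..., tau_(n-1)), in indices starting
   at 1, of a representative with tau_1 = 0; they determine a point of PH lam
   when lam_1 != 1, and are unique up to a common nonzero factor. *)
Definition homog_coords (X : set (Lambda n -> aff F)) (t : 'rV[F]_(n - 2)) :
    Prop :=
  exists2 rho, X rho & aff_tr (rho (alpha n 0)) = 0%R /\
    forall j : 'I_(n - 2), aff_tr (rho (alpha n j.+1)) = t ord0 j.

Definition lam_ends (a : F) (i : 'I_n) : F :=
  if i == 0 :> nat then a else if i == n.-1 :> nat then a^-1%R else 1%R.

End Rep.

(* Main.v *)
Require Import Defs.
From mathcomp Require Import all_boot all_order all_algebra.
From mathcomp Require Import boolp classical_sets functions cardinality reals.
From mathcomp Require Import complex.
From mathcomp Require Import zify ring.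

(* Let t_2, ..., t_(n-1) be the translation parts of the middle generators.
   Since their linear part is 1, conjugation by z |-> c z + d multiplies all of
   them by c, and as a <> 1 the conjugacy class of rho is determined by
   (t_2, ..., t_(n-1)) up to a common scalar.  The square of sigma_(i,j)
   conjugates alpha_i by a conjugate of alpha_j and vice versa, so it multiplies
   t_i by lambda_j and t_j by lambda_i.  As lambda = (a, 1, ..., 1, a^-1), the
   pure braid group acts through the torus of all diagonal matrices with entries
   in the powers of a, modulo scalars; its orbits on the points with k nonzero
   coordinates are torsors under <a>^k / <a>. *)

Import GRing.Theory.
Local Open Scope classical_set_scope.
Local Open Scope ring_scope.

Local Notation monoid_morphism := monoid.monoid_morphism.

(** * Cardinality of an injectively parametrized set *)

Lemma card_range_inj (T : finType) (U : Type) (g : T -> U) :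
  injective g -> (range g #= `I_#|T|)%card.
Proof.
move=> ginj; have -> : range g = range (fun i : 'I_#|T| => g (enum_val i)).
  apply/seteqP; split=> _ [x _ <-]; last by exists (enum_val x).
  by exists (enum_rank x); rewrite ?enum_rankK.
apply: (card_eq_trans _ (card_esym card_II)).
by apply: inj_card_eq => x y _ _ /ginj; exact: enum_val_inj.
Qed.

(** * Conjugation in the affine group *)

Section AffConj.
Set Implicit Arguments.
Unset Strict Implicit.
Variable F : fieldType.
Implicit Types f g : aff F.

Lemma aff_linM f g : aff_lin (f * g)%g = aff_lin f * aff_lin g.
Proof. by []. Qed.

Lemma aff_trM f g : aff_tr (f * g)%g = aff_lin f * aff_tr g + aff_tr f.
Proof. by []. Qed.

Lemma aff_lin_conj f g : aff_lin (f * g * f^-1)%g = aff_lin g.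
Proof.
rewrite !aff_linM [aff_lin f^-1%g](erefl : _ = (aff_lin f)^-1).
by rewrite mulrAC mulfV ?mul1r ?aff_lin_neq0.
Qed.

Lemma aff_tr_conj f g : aff_tr (f * g * f^-1)%g =
  aff_lin f * aff_tr g + (1 - aff_lin g) * aff_tr f.
Proof.
rewrite !aff_trM aff_linM.
rewrite [aff_tr f^-1%g](erefl : _ = - ((aff_lin f)^-1 * aff_tr f)).
by field; exact: aff_lin_neq0.
Qed.

End AffConj.

(** * Squared half-twists and the generators of the sphere group *)

Section HurwitzSquare.
Variable n : nat.
Local Open Scope group_scope.

(** The half-twist fixes the product [Q] of the generators strictly between, so iterating its
    formulas closes up. The conjugators [u] stay unspecified: conjugating by [u] does not change the
    linear part of the image of a generator, and only that part enters later. *)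
Lemma Hur_sigma_sqr i j : (i < j < n)%N ->
  [/\ exists u, Hur (sigma n i j ^+ 2) (alpha n i) =
        (u * alpha n j * u^-1) * alpha n i * (u * alpha n j * u^-1)^-1,
      exists u, Hur (sigma n i j ^+ 2) (alpha n j) =
        (u * alpha n i * u^-1) * alpha n j * (u * alpha n i * u^-1)^-1
    & forall k : nat, k != i -> k != j ->
        Hur (sigma n i j ^+ 2) (alpha n k) = alpha n k].
Proof.
move=> ijn; have [Hi Hj Hk] := Hur_sigma ijn.
have ij : (i < j)%N by case/andP: ijn.
set Q := \prod_(i.+1 <= k < j) alpha n k in Hj.
have PE : \prod_(i <= k < j) alpha n k = alpha n i * Q by rewrite big_ltn.
rewrite PE in Hi.
have HQ : Hur (sigma n i j) Q = Q.
  rewrite (big_morph _ (aut_morphism (Hur (sigma n i j))).2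
    (aut_morphism (Hur (sigma n i j))).1).
  by apply: eq_big_nat => k kj; apply: Hk; lia.
have HE x : Hur (sigma n i j ^+ 2) x = Hur (sigma n i j) (Hur (sigma n i j) x).
  by rewrite expgS expg1 HurM.
split.
(* The conjugating factor is the image of [alpha n i] under the half-twist itself. *)
- exists (alpha n i * Q).
  rewrite HE Hi !autM autV !autM HQ Hj Hi.
  by rewrite !invgM !invgK !mulgA !(mulgK, mulgVK).
- exists Q^-1.
  rewrite HE Hj !autM autV HQ Hi.
  by rewrite !invgM !invgK !mulgA.
- by move=> k ki kj; rewrite HE !Hk.
Qed.

(** A coordinate index [j] refers to the generator [j.+1]; the generators 0 and [n.-1] are the two
    ends. *)
Lemma mid_lt (j : 'I_(n - 2)) : (j.+1 < n.-1)%N.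
Proof. by case: j => j /=; lia. Qed.

Lemma mid_ltn (j : 'I_(n - 2)) : (j.+1 < n)%N.
Proof. by have := mid_lt j; lia. Qed.

Lemma prod_nat_last (G : groupType) (f : nat -> G) : (0 < n)%N ->
  \prod_(0 <= i < n) f i = (\prod_(0 <= i < n.-1) f i) * f n.-1.
Proof. by move=> n0; rewrite -{1}(prednK n0) big_nat_recr. Qed.

(** The defining relation expresses the last generator through the others. *)
Lemma Lambda_ext_last (G : groupType) (h h' : Lambda n -> G) :
    monoid_morphism h -> monoid_morphism h' ->
  (forall i, (i < n.-1)%N -> h (alpha n i) = h' (alpha n i)) -> h = h'.
Proof.
move=> hm hm' e; apply: Lambda_ext => // i ltin.
have [lti|gei] := ltnP i n.-1; first exact: e.
have n0 : (0 < n)%N by apply: leq_ltn_trans ltin.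
have -> : i = n.-1 by lia.
have := prod_alpha n; rewrite prod_nat_last // => p1.
have prodE : h (\prod_(0 <= i < n.-1) alpha n i) =
             h' (\prod_(0 <= i < n.-1) alpha n i).
  rewrite (big_morph _ hm.2 hm.1) (big_morph _ hm'.2 hm'.1).
  by apply: eq_big_nat => k /andP[_]; exact: e.
apply: (@mulgI _ (h (\prod_(0 <= i < n.-1) alpha n i))).
by rewrite -hm.2 prodE -hm'.2 p1 hm.1 hm'.1.
Qed.

End HurwitzSquare.

(** * Conjugacy classes of affine representations *)

Section ConjClass.
Set Implicit Arguments.
Unset Strict Implicit.
Variables (F : fieldType) (n : nat).
Implicit Types rho : Lambda n -> aff F.

Lemma conj_class_eqP rho rho' :
  conj_class rho = conj_class rho' <-> conj_class rho rho'.
Proof.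
split=> [->|[g _ <-]].
  by exists 1%g => //; apply/funext => x; rewrite mul1g invg1 mulg1.
apply/seteqP; split=> _ [h _ <-].
  exists (h * g^-1)%g => //; apply/funext => x.
  by rewrite invgM invgK !mulgA !mulgVK.
by exists (h * g)%g => //; apply/funext => x; rewrite invgM !mulgA.
Qed.

Lemma Hom_aff_conj rho g :
  Hom_aff rho -> Hom_aff (fun x => g * rho x * g^-1)%g.
Proof.
move=> [r1 rM]; split=> [|x y]; first by rewrite r1 mulg1 mulgV.
by rewrite rM !mulgA mulgVK.
Qed.

Lemma Hom_affV rho x : Hom_aff rho -> rho x^-1%g = (rho x)^-1%g.
Proof. by move=> h; exact: morphV. Qed.

Lemma aff_lin_rho_conj rho u x : Hom_aff rho ->
  aff_lin (rho (u * x * u^-1)%g) = aff_lin (rho x).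
Proof. by move=> h; rewrite !h.2 Hom_affV // aff_lin_conj. Qed.

Lemma aff_tr_rho_conj rho u x : Hom_aff rho ->
  aff_tr (rho (u * x * u^-1)%g) = aff_lin (rho u) * aff_tr (rho x) +
    (1 - aff_lin (rho x)) * aff_tr (rho u).
Proof. by move=> h; rewrite !h.2 Hom_affV // aff_tr_conj. Qed.

End ConjClass.

(** * Projective coordinates for the linear part (a, 1, ..., 1, 1/a) *)

Section EndsLinearPart.
Set Implicit Arguments.
Unset Strict Implicit.
Variables (F : fieldType) (n : nat) (a : F).
Local Notation Hom_lam := (Hom_lin (@lam_ends F n a)).
Implicit Types (rho : Lambda n -> aff F) (v w : 'rV[F]_(n - 2)).

(** Linear parts are recorded as integer exponents of [a], the form in which they enter the torus
    action. *)
Definition ends_exp (k : nat) : int :=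
  if k == 0%N then 1 else if k == n.-1 then -1 else 0.

Lemma lam_endsE (i : 'I_n) : lam_ends a i = a ^ ends_exp i.
Proof.
rewrite /lam_ends /ends_exp; case: eqP => // _; case: eqP => // _.
Qed.

Lemma Hom_lamP rho :
  Hom_lam rho <-> Hom_aff rho /\
    forall k, (k < n)%N -> aff_lin (rho (alpha n k)) = a ^ ends_exp k.
Proof.
split=> -[hm hl]; split=> //.
  by move=> k kn; rewrite (hl (Ordinal kn)) lam_endsE.
by move=> i; rewrite hl // lam_endsE.
Qed.

Lemma ends_exp_mid (j : 'I_(n - 2)) : ends_exp j.+1 = 0.
Proof. by rewrite /ends_exp /= ltn_eqF // mid_lt. Qed.

Lemma aff_lin_mid rho (j : 'I_(n - 2)) :
  Hom_lam rho -> aff_lin (rho (alpha n j.+1)) = 1.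
Proof. by move=> /Hom_lamP[_ ->]; rewrite ?mid_ltn // ends_exp_mid. Qed.

Definition mid_tr rho : 'rV[F]_(n - 2) :=
  \row_j aff_tr (rho (alpha n j.+1)).

Lemma mid_tr_conj rho g : Hom_lam rho ->
  mid_tr (fun x => g * rho x * g^-1)%g = aff_lin g *: mid_tr rho.
Proof.
move=> h; apply/rowP => j.
by rewrite !mxE aff_tr_conj aff_lin_mid // subrr mul0r addr0.
Qed.

Lemma Hom_lam_conj rho rho' :
  Hom_lam rho -> conj_class rho rho' -> Hom_lam rho'.
Proof.
move=> [hm hl] [g _ <-]; split; first exact: Hom_aff_conj.
by move=> i; rewrite aff_lin_conj.
Qed.

Hypotheses (n_ge3 : (2 < n)%N) (a_neq0 : a != 0).

Definition transl (t : F) : aff F := Aff (oner_neq0 F : (1, t).1 != 0).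
Definition dilation : aff F := Aff (a_neq0 : (a, 0).1 != 0).

(** The predecessor undoes the shift [j.+1] of [mid_tr]; indices from [n.-1] on get the default
    value 0. *)
Definition mid_coord v (k : nat) : F := if insub k.-1 is Some j then v 0 j else 0.

(** Normalized representative: the first generator fixes the origin, the middle ones are
    translations by [v], and the relation forces the last. *)
Definition rep_gen v (k : nat) : aff F :=
  if k == 0%N then dilation
  else if k == n.-1 then
    (dilation * \prod_(1 <= i < n.-1) transl (mid_coord v i))^-1%g
  else transl (mid_coord v k).

Definition rep v : Lambda n -> aff F := plift (fun i : 'I_n => rep_gen v i).

Lemma prod_rep_gen v : (\prod_(0 <= i < n) rep_gen v i)%g = 1%g.
Proof.
have [n0 n1] : (0 < n /\ 0 < n.-1)%N by lia.
rewrite prod_nat_last // big_ltn //.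
have -> : (\prod_(1 <= i < n.-1) rep_gen v i =
   \prod_(1 <= i < n.-1) transl (mid_coord v i))%g.
  apply: eq_big_nat => i /andP[i0 ilt]; rewrite /rep_gen.
  by rewrite (gtn_eqF i0) (ltn_eqF ilt).
by rewrite {2}/rep_gen (gtn_eqF n1) eqxx; exact: mulgV.
Qed.

Lemma rep_morph v : Hom_aff (rep v).
Proof. exact: (Lambda_lift (prod_rep_gen v)).1. Qed.

Lemma rep_alpha v k : (k < n)%N -> rep v (alpha n k) = rep_gen v k.
Proof. exact: (Lambda_lift (prod_rep_gen v)).2. Qed.

Lemma aff_lin_transl_prod v m :
  aff_lin (\prod_(1 <= i < m) transl (mid_coord v i))%g = 1.
Proof.
apply: (big_ind (fun g => aff_lin g = 1)) => // f g ef eg.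
by rewrite aff_linM ef eg mulr1.
Qed.

Lemma rep_Hom_lam v : Hom_lam (rep v).
Proof.
apply/Hom_lamP; split=> [|k kn]; first exact: rep_morph.
rewrite rep_alpha // /rep_gen /ends_exp; case: eqP => // _; case: eqP => // _.
rewrite [LHS](erefl : _ = (aff_lin _)^-1) aff_linM aff_lin_transl_prod mulr1.
by [].
Qed.

Lemma mid_tr_rep v : mid_tr (rep v) = v.
Proof.
apply/rowP => j; rewrite !mxE rep_alpha ?mid_ltn // /rep_gen /=.
rewrite ltn_eqF ?mid_lt // [LHS](erefl : _ = mid_coord v j.+1).
by rewrite /mid_coord /= valK.
Qed.

Lemma rep0_no_translation : no_translation (rep 0).
Proof.
have t0 k : transl (mid_coord 0 k) = 1%g.
  apply: aff_eq => //; rewrite [LHS](erefl : _ = mid_coord 0 k) /mid_coord.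
  by case: insub => [j|//]; rewrite mxE.
move=> i; rewrite rep_alpha // /rep_gen; case: eqP => // _.
case: eqP => [_|_]; last by rewrite t0.
rewrite big1 => [|k _]; last exact: t0.
by rewrite mulg1 [LHS](erefl : _ = - (a^-1 * 0)) mulr0 oppr0.
Qed.

Hypothesis a_neq1 : a != 1.

(** A conjugator has two parameters: its linear part scales the middle translations, and its
    translation part adjusts the first generator because [a] differs from 1. The last generator then
    follows from the relation. *)
Lemma conj_mid_trP rho rho' : Hom_lam rho -> Hom_lam rho' ->
  conj_class rho = conj_class rho' <->
  exists2 c, c != 0 & mid_tr rho' = c *: mid_tr rho.
Proof.
move=> h h'; rewrite conj_class_eqP; split=> [[g _ <-]|[c c0 e]].
  by exists (aff_lin g); [exact: aff_lin_neq0 | exact: mid_tr_conj].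
have /Hom_lamP[hm hl] := h; have /Hom_lamP[hm' hl'] := h'.
(* [b] solves c t + (1 - a) b = t', where t and t' are the translation parts of the first generator
   under [rho] and [rho']. *)
pose b := (aff_tr (rho' (alpha n 0)) - c * aff_tr (rho (alpha n 0))) / (1 - a).
pose g := Aff (c0 : (c, b).1 != 0).
exists g => //; apply: Lambda_ext_last => //; first exact: Hom_aff_conj.
move=> [|k] kn; apply: aff_eq; rewrite ?aff_lin_conj ?hl ?hl' //; try lia.
  rewrite aff_tr_conj hl /ends_exp //=; last lia.
  rewrite [aff_lin g](erefl : _ = c) [aff_tr g](erefl : _ = b) /b expr1z.
  by field; rewrite subr_eq0 eq_sym.
have kn2 : (k < n - 2)%N by lia.
have := congr1 (fun v => v 0 (Ordinal kn2)) e; rewrite !mxE /= => ->.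
by rewrite aff_tr_conj (@aff_lin_mid _ (Ordinal kn2)) // subrr mul0r addr0.
Qed.

(** Being conjugate to a linear representation amounts to vanishing middle translations: [rep 0] is
    linear, and conjugation only rescales [mid_tr]. *)
Lemma PHP (X : set (Lambda n -> aff F)) :
  PH (@lam_ends F n a) X <-> exists2 v, v != 0 & X = conj_class (rep v).
Proof.
split=> [[rho [h nt] <-]|[v v0 ->]].
  exists (mid_tr rho).
    apply/eqP => m0; apply: nt; exists (rep 0); last exact: rep0_no_translation.
    apply/conj_class_eqP/conj_mid_trP => //; first exact: rep_Hom_lam.
    by exists 1; rewrite ?oner_neq0 // mid_tr_rep m0 scaler0.
  apply/conj_mid_trP => //; first exact: rep_Hom_lam.
  by exists 1; rewrite ?oner_neq0 // mid_tr_rep scale1r.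
exists (rep v) => //; split=> [|[rho' c nt]]; first exact: rep_Hom_lam.
have h' := Hom_lam_conj (rep_Hom_lam v) c.
move/conj_class_eqP: c => /(conj_mid_trP (rep_Hom_lam v) h')[c c0 e].
move/eqP: v0; apply.
have : c *: v = 0.
  rewrite -{1}[v]mid_tr_rep -e; apply/rowP => j; rewrite !mxE.
  exact: (nt (Ordinal (mid_ltn j))).
by move/eqP; rewrite scaler_eq0 (negPf c0) => /eqP.
Qed.

Lemma point_mid_tr rho : Hom_lam rho ->
  conj_class rho = conj_class (rep (mid_tr rho)).
Proof.
move=> h; apply/conj_mid_trP => //; first exact: rep_Hom_lam.
by exists 1; rewrite ?oner_neq0 // mid_tr_rep scale1r.
Qed.

Lemma point_eqP v w :
  conj_class (rep v) = conj_class (rep w) <-> exists2 c, c != 0 & w = c *: v.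
Proof.
by rewrite conj_mid_trP ?mid_tr_rep //; exact: rep_Hom_lam.
Qed.

End EndsLinearPart.

(** * Braids acting by diagonal matrices *)

Section BraidAction.
Set Implicit Arguments.
Unset Strict Implicit.
Variables (F : fieldType) (n : nat) (a : F).
Hypotheses (n_ge3 : (2 < n)%N) (a_neq0 : a != 0) (a_neq1 : a != 1).
Local Notation lam := (@lam_ends F n a).
Local Notation Hom_lam := (Hom_lin lam).
Implicit Types (rho : Lambda n -> aff F) (v w : 'rV[F]_(n - 2)).
Implicit Types (b c : Braid n) (e f : 'rV[int]_(n - 2)).

Lemma Hom_aff_Hur rho b : Hom_aff rho -> Hom_aff (rho \o Hur b).
Proof. by move=> h; apply: morphism_comp => //; exact: aut_morphism. Qed.

(** The diagonal matrix with entries a^(e_j). Keeping exponents rather than powers makes products of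
    braids correspond to sums of integer vectors. *)
Definition torus_act e v : 'rV[F]_(n - 2) := \row_j (a ^ e 0 j * v 0 j).

Lemma torus_act0 v : torus_act 0 v = v.
Proof. by apply/rowP => j; rewrite !mxE expr0z mul1r. Qed.

Lemma torus_actD e f v : torus_act (e + f) v = torus_act e (torus_act f v).
Proof. by apply/rowP => j; rewrite !mxE expfzDr // mulrA. Qed.

(* The first condition is stated for all rho, not only for those with linear
   part lam, so that it passes to inverses in acts_diagV. *)
Definition acts_diag b e : Prop := forall rho, Hom_aff rho ->
  (forall k, (k < n)%N ->
     aff_lin (rho (Hur b (alpha n k))) = aff_lin (rho (alpha n k))) /\
  (Hom_lam rho -> mid_tr (rho \o Hur b) = torus_act e (mid_tr rho)).

Lemma Hom_lam_Hur rho b e :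
  acts_diag b e -> Hom_lam rho -> Hom_lam (rho \o Hur b).
Proof.
move=> be [hm hl]; split=> [|i]; first exact: Hom_aff_Hur.
by rewrite -hl; apply: (be _ hm).1.
Qed.

Lemma acts_diag1 : acts_diag 1%g 0.
Proof.
move=> rho h; split=> [k _|_]; first by rewrite Hur1.
by rewrite Hur1 torus_act0.
Qed.

(** Since [Hur] is an antimorphism, acting by [b * c] precomposes [rho] first with [Hur c], which
    keeps the linear part, and then with [Hur b]. *)
Lemma acts_diagM b c e f :
  acts_diag b e -> acts_diag c f -> acts_diag (b * c)%g (e + f).
Proof.
move=> be cf rho h; split=> [k kn|hl].
  rewrite HurM aut_mulE.
  by rewrite ((be _ (Hom_aff_Hur c h)).1 k kn) ((cf _ h).1 k kn).
have hc := Hom_lam_Hur cf hl.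
rewrite torus_actD -(cf _ h).2 // -(be _ hc.1).2 //.
by congr mid_tr; rewrite HurM.
Qed.

Lemma acts_diagV b e : acts_diag b e -> acts_diag b^-1%g (- e).
Proof.
move=> be rho h.
have hV := Hom_aff_Hur b^-1%g h.
(* The hypothesis on [b], applied to [rho \o Hur b^-1], thus compares that representation with
   [rho]. *)
have bK : (rho \o Hur b^-1%g) \o Hur b = rho.
  apply/funext => x; congr rho.
  by have := congr1 (fun g : aut _ => g x) (HurM b b^-1%g); rewrite mulgV Hur1.
have lV k : (k < n)%N ->
    aff_lin (rho (Hur b^-1%g (alpha n k))) = aff_lin (rho (alpha n k)).
  by move=> kn; rewrite -[RHS](congr1 (fun r => aff_lin (r (alpha n k))) bK)
    ((be _ hV).1 k kn).
split=> [//|hl].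
have hlV : Hom_lam (rho \o Hur b^-1%g).
  by split=> [//|i]; rewrite /= lV // hl.2.
have := (be _ hV).2 hlV; rewrite bK => ->.
by rewrite -torus_actD addNr torus_act0.
Qed.

(* Each of alpha_i and alpha_j is conjugated by a conjugate of the other, so
   its translation gets multiplied by the linear part of the other. *)
Lemma acts_diag_sigma i j : (i < j < n)%N ->
  acts_diag (sigma n i j ^+ 2)%g
    (\row_m if m.+1 == i then ends_exp n j
            else if m.+1 == j then ends_exp n i else 0).
Proof.
move=> ijn rho h; have [[u Hi] [w Hj] Hk] := Hur_sigma_sqr ijn.
split=> [k kn|/[dup] hl /Hom_lamP[_ hlin]].
  have [->|ki] := eqVneq k i; first by rewrite Hi aff_lin_rho_conj.
  have [->|kj] := eqVneq k j; first by rewrite Hj aff_lin_rho_conj.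
  by rewrite Hk.
have l1 m : aff_lin (rho (alpha n (m : 'I_(n - 2)).+1)) = 1.
  exact: (aff_lin_mid m hl).
apply/rowP => m; rewrite !mxE.
rewrite -[(rho \o _) _]/(rho (Hur (sigma n i j ^+ 2)%g (alpha n m.+1))).
case: eqP => [mi|/eqP mi].
  rewrite mi Hi aff_tr_rho_conj // aff_lin_rho_conj // -mi l1 subrr mul0r addr0.
  by rewrite hlin //; lia.
case: eqP => [mj|/eqP mj].
  rewrite mj Hj aff_tr_rho_conj // aff_lin_rho_conj // -mj l1 subrr mul0r addr0.
  by rewrite hlin //; lia.
by rewrite Hk // expr0z mul1r.
Qed.

Lemma PureBraid_acts b : PureBraid n b -> exists e, acts_diag b e.
Proof.
(* The diagonally acting braids form a subgroup containing the generators, hence contain the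
   smallest such subgroup. *)
move=> pb; apply: (pb [set b | exists e, acts_diag b e]).
split=> [|_ [i [j [ijn ->]]]]; last first.
  by eexists; exact: acts_diag_sigma ijn.
split=> [|x y [e xe] [f yf]]; first by exists 0; exact: acts_diag1.
by exists (e - f); apply: acts_diagM => //; exact: acts_diagV.
Qed.

(** * Realizing every exponent vector by a pure braid *)

Lemma PureBraid1 : PureBraid n 1%g.
Proof. by move=> A [[]]. Qed.

Lemma PureBraid_div b c : PureBraid n b -> PureBraid n c -> PureBraid n (b / c)%g.
Proof.
move=> pb pc A AP; case: (AP) => -[A1 AD] _; apply: AD; [exact: pb|exact: pc].
Qed.

Lemma PureBraidV b : PureBraid n b -> PureBraid n b^-1%g.
Proof.
by move=> pb; rewrite -[b^-1%g]mul1g; exact: PureBraid_div PureBraid1 pb.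
Qed.

Lemma PureBraidM b c : PureBraid n b -> PureBraid n c -> PureBraid n (b * c)%g.
Proof.
by move=> pb pc; rewrite -[c]invgK; exact: PureBraid_div pb (PureBraidV pc).
Qed.

Lemma PureBraid_sigma i j : (i < j < n)%N -> PureBraid n (sigma n i j ^+ 2)%g.
Proof. by move=> ijn A [_]; apply; exists i, j. Qed.

(** Twisting the first strand, of linear part [a], around strand [m.+1] multiplies coordinate [m]
    alone by [a]; these unit vectors generate all integer vectors. *)
Lemma acts_PureBraid e : exists2 b, PureBraid n b & acts_diag b e.
Proof.
pose Q e := exists2 b, PureBraid n b & acts_diag b e.
have Q0 : Q 0 by exists 1%g; [exact: PureBraid1 | exact: acts_diag1].
have QD x y : Q x -> Q y -> Q (x + y).
  move=> [b pb bx] [c pc cy]; exists (b * c)%g; first exact: PureBraidM.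
  exact: acts_diagM.
have QN x : Q x -> Q (- x).
  move=> [b pb bx]; exists (b^-1)%g; first exact: PureBraidV.
  exact: acts_diagV.
have QMn x k : Q x -> Q (x *+ k).
  by move=> qx; elim: k => [//|k IHk]; rewrite mulrS; exact: QD.
rewrite -/(Q e) (row_sum_delta e); apply: big_ind => // m _.
rewrite -[e 0 m]intz scaler_int.
suff qd : Q (delta_mx 0 m).
  by case: (e 0 m) => k; [exact: QMn | apply/QN/QMn].
have mn := mid_ltn m.
exists (sigma n 0 m.+1 ^+ 2)%g; first by apply: PureBraid_sigma.
have := @acts_diag_sigma 0 m.+1; rewrite /= mn => /(_ isT).
set d := (X in acts_diag _ X) => bd.
suff -> : delta_mx 0 m = d by [].
apply/rowP => k; rewrite !mxE eqSS.
by have [->|km] := eqVneq k m; rewrite ?eqxx // ifF //; apply/negbTE.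
Qed.

(** * Orbits of points under the torus *)

Definition point v := conj_class (rep a_neq0 v).

Lemma braid_act_point b e v :
  acts_diag b e -> braid_act b (point v) = point (torus_act e v).
Proof.
move=> be; have hv := rep_Hom_lam n_ge3 a_neq0 v.
rewrite /point braid_act_class.
rewrite (point_mid_tr n_ge3 a_neq0 a_neq1 (Hom_lam_Hur be hv)).
by rewrite (be _ hv.1).2 // mid_tr_rep.
Qed.

Lemma pb_orbit_point v :
  pb_orbit (point v) = range (fun e => point (torus_act e v)).
Proof.
apply/seteqP; split=> [_ [b pb <-]|_ [e _ <-]].
  by have [e be] := PureBraid_acts pb; exists e => //; rewrite (braid_act_point _ be).
by have [b pb be] := acts_PureBraid e; exists b => //; exact: braid_act_point.
Qed.

Lemma pb_fixed_pointP v :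
  pb_fixed (point v) <-> forall e, point (torus_act e v) = point v.
Proof.
split=> [fv e|fv b pb].
  by have [b pb /braid_act_point <-] := acts_PureBraid e; exact: fv.
by have [e /braid_act_point ->] := PureBraid_acts pb.
Qed.

(** Equal exponents at one nonzero coordinate force the projective scalar to be 1, so that
    coordinate [i] normalizes the others. *)
Lemma eq_torus_act e f v i j : v 0 i != 0 -> v 0 j != 0 -> e 0 i = f 0 i ->
  point (torus_act e v) = point (torus_act f v) -> a ^ e 0 j = a ^ f 0 j.
Proof.
move=> vi vj efi /(point_eqP n_ge3 a_neq0 a_neq1)[c _ ec].
have := congr1 (fun w => w 0 i) ec; rewrite !mxE efi mulrA => /(mulIf vi).
rewrite -{1}[_ ^ _]mul1r => /(mulIf (expfz_neq0 _ a_neq0)) c1.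
have := congr1 (fun w => w 0 j) ec; rewrite !mxE -c1 mul1r => /(mulIf vj).
by [].
Qed.

(** * Supports and fixed points *)

Definition supp v := [set j | v 0 j != 0]%SET.

Lemma supp_neq0 v : v != 0 -> exists i, i \in supp v.
Proof.
move=> v0; apply/set0Pn; apply: contra_neq v0 => s0; apply/rowP => i; rewrite mxE.
by have := finset.in_set0 i; rewrite -s0 inE => /negbFE/eqP.
Qed.

Lemma supp1P v i : supp v = [set i]%SET -> v = v 0 i *: delta_mx 0 i.
Proof.
move=> sv; apply/rowP => j; rewrite !mxE eqxx /=.
have [->|ji] := eqVneq j i; first by rewrite mulr1.
rewrite mulr0; apply/eqP; apply: contraNT ji => vj.
by have : j \in supp v by [rewrite inE]; rewrite sv inE.
Qed.

Lemma supp_delta i : supp (delta_mx 0 i) = [set i]%SET.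
Proof.
apply/setP => j; rewrite !inE mxE eqxx.
by case: (j == i); rewrite ?mulr1n ?mulr0n ?oner_eq0 ?eqxx.
Qed.

Lemma pb_fixed_supp v : v != 0 -> pb_fixed (point v) <-> #|supp v| = 1%N.
Proof.
move=> v0; rewrite pb_fixed_pointP; split=> [fv|/eqP/cards1P[i sv] e].
  have [i si] := supp_neq0 v0; apply/eqP/cards1P; exists i.
  apply/setP => j; rewrite [in RHS]inE; apply/idP/eqP => [sj|-> //].
  apply/eqP; apply: contraNT a_neq1 => ji; rewrite !inE in si sj.
  (* With a second nonzero coordinate [j], scaling it alone by [a] while keeping [i] would give a =
     1. *)
  have e0 : (delta_mx 0 j : 'rV[int]_(n - 2)) 0 i = (0 : 'rV[int]_(n - 2)) 0 i.
    by rewrite !mxE eqxx eq_sym (negPf ji).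
  have := eq_torus_act si sj e0; rewrite torus_act0 => /(_ (fv _)).
  by rewrite !mxE !eqxx expr1z expr0z => ->.
(* A single nonzero coordinate is only rescaled, and this scalar undoes it. *)
apply/(point_eqP n_ge3 a_neq0 a_neq1); exists (a ^ (- e 0 i)).
  exact: expfz_neq0.
rewrite (supp1P sv); apply/rowP => j; rewrite !mxE eqxx /=.
have [->|ji] := eqVneq j i; last by rewrite !mulr0.
by rewrite [RHS]mulrA -expfzDr // addNr expr0z mul1r.
Qed.

(** The fixed points are the coordinate points [0 : ... : 1 : ... : 0], which are pairwise
    distinct. *)
Lemma card_fixed_points :
  ([set X | PH lam X /\ pb_fixed X] #= `I_(n - 2))%card.
Proof.
pose pt (i : 'I_(n - 2)) := point (delta_mx 0 i).
have -> : [set X | PH lam X /\ pb_fixed X] = range pt.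
  apply/seteqP; split=> [X [/(PHP n_ge3 a_neq0 a_neq1)[v v0 ->]]|_ [i _ <-]].
    move=> /(pb_fixed_supp v0)/eqP/cards1P[i sv]; exists i => //.
    have vi : v 0 i != 0 by have := set11 i; rewrite -sv inE.
    by apply/(point_eqP n_ge3 a_neq0 a_neq1); exists (v 0 i); last exact: supp1P.
  have d0 : delta_mx 0 i != 0 :> 'rV[F]_(n - 2).
    apply/eqP => /(congr1 supp); rewrite supp_delta => /setP/(_ i).
    by rewrite !inE mxE !eqxx.
  split; first by apply/(PHP n_ge3 a_neq0 a_neq1); eexists; first exact: d0.
  by apply/(pb_fixed_supp d0); rewrite supp_delta cards1.
rewrite -[X in `I_X]card_ord; apply: card_range_inj => i j.
move=> /(point_eqP n_ge3 a_neq0 a_neq1)[c _ /(congr1 (fun w => w 0 j))].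
rewrite !mxE !eqxx /=; have [//|_] := eqVneq j i.
by rewrite mulr0 => /eqP; rewrite oner_eq0.
Qed.

(** * Size and finiteness of orbits *)

Lemma card_pb_orbit v omega : v != 0 -> omega.-primitive_root a ->
  (pb_orbit (point v) #= `I_(omega ^ (#|supp v| - 1)))%card.
Proof.
move=> v0 prim; have [i si] := supp_neq0 v0.
pose S := (supp v :\ i)%SET.
(* Normal form of exponents: 0 at the chosen coordinate [i] and off the support, a residue modulo
   [omega] elsewhere. *)
pose expo (g : {ffun {j | j \in S} -> 'I_omega}) : 'rV[int]_(n - 2) :=
  \row_j (if insub j is Some s then Posz (g s) else 0).
have expo_i g : expo g 0 i = 0 by rewrite mxE insubF // !inE eqxx.
have expo_s g s : expo g 0 (val s) = g s by rewrite mxE valK.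
have vi : v 0 i != 0 by move: si; rewrite inE.
have -> : pb_orbit (point v) = range (fun g => point (torus_act (expo g) v)).
  rewrite pb_orbit_point; apply/seteqP; split=> _ [x _ <-]; last by exists (expo x).
  (* Dividing by the scalar at [i] leaves roots of unity of order dividing [omega], hence powers of
     [a] with exponent below [omega]. *)
  have rt s : (a ^ (x 0 (val (s : {j | j \in S})) - x 0 i)) ^+ omega = 1.
    by rewrite exprnP exprz_exp mulrC -exprz_exp -exprnP prim_expr_order ?exp1rz.
  exists [ffun s => sval (prim_rootP prim (rt s))] => //.
  apply/esym/(point_eqP n_ge3 a_neq0 a_neq1).
  exists (a ^ (- x 0 i)); first exact: expfz_neq0.
  apply/rowP => j; rewrite !mxE mulrA -expfzDr //.
  have [s js|] := insubP {j | j \in S} j.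
    move=> <-; rewrite ffunE; case: prim_rootP => r /= rE.
    by rewrite -exprnP -rE addrC.
  rewrite !inE negb_and !negbK => /orP[/eqP->|/eqP->]; last by rewrite !mulr0.
  by rewrite addNr.
have cS : (#|supp v| - 1 = #|S|)%N by rewrite (cardsD1 i) si addKn.
have -> : (omega ^ (#|supp v| - 1) = #|{ffun {j | j \in S} -> 'I_omega}|)%N.
  by rewrite card_ffun card_ord card_sig cS.
apply: card_range_inj => g h gh; apply/ffunP => s; apply/val_inj/eqP => /=.
have vs : v 0 (val s) != 0 by have := valP s; rewrite !inE => /andP[].
have := eq_torus_act vi vs (etrans (expo_i g) (esym (expo_i h))) gh.
by rewrite !expo_s -!exprnP => /eqP; rewrite (eq_prim_root_expr prim) !modn_small.
Qed.

Lemma finite_pb_orbitP v : v != 0 -> #|supp v| <> 1%N ->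
  finite_set (pb_orbit (point v)) <-> exists2 m : nat, (0 < m)%N & a ^+ m = 1.
Proof.
move=> v0 k1; split=> [fin|[m m0 /(prim_order_exists m0)[omega prim _]]]; last first.
  by apply/finite_setP; eexists; exact: card_pb_orbit prim.
have [i si] := supp_neq0 v0.
have [j] : exists j, j \in (supp v :\ i)%SET.
  apply/set0Pn/eqP => s0; apply: k1; rewrite (cardsD1 i) si s0 cards0 //.
rewrite !inE in si *; move=> /andP[ji sj].
(* If [a] is not a root of unity, multiplying coordinate [j] by the powers of [a] with [i] kept
   fixed embeds the natural numbers in the orbit. *)
apply: contrapT => nroot; apply: infinite_nat.
pose e (m : nat) : 'rV[int]_(n - 2) := Posz m *: delta_mx 0 j.
pose g m := point (torus_act (e m) v).
have ginj : injective g.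
  have lt_eq m m' : (m < m')%N -> g m <> g m'.
    move=> mm' gg; apply: nroot; exists (m' - m)%N; first by rewrite subn_gt0.
    have e0 : e m 0 i = e m' 0 i by rewrite !mxE eqxx eq_sym (negPf ji) !mulr0.
    have := eq_torus_act si sj e0 gg; rewrite !mxE !eqxx !mulr1 -!exprnP => em.
    apply: (@mulIf _ (a ^+ m)); first exact: expf_neq0.
    by rewrite -exprD subnK ?mul1r // ltnW.
  move=> m m' gg; case: (ltngtP m m') => // mm'; first by case: (lt_eq _ _ mm').
  by case: (lt_eq _ _ mm').
apply: (@sub_finite_set _ _ (g @^-1` pb_orbit (point v))).
  by move=> m _ /=; rewrite pb_orbit_point; exists (e m).
by apply: finite_preimage => // x y _ _; exact: ginj.
Qed.

(** * Homogeneous coordinates of a class *)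

Lemma homog_coords_point rho t : Hom_lam rho ->
  homog_coords (conj_class rho) t -> conj_class rho = point t.
Proof.
move=> h [rho' c [_ tE]]; have h' := Hom_lam_conj h c.
move/conj_class_eqP: c => ->.
rewrite (point_mid_tr n_ge3 a_neq0 a_neq1 h'); congr (point _).
by apply/rowP => j; rewrite mxE tE.
Qed.

Lemma PH_pointP v : PH lam (point v) <-> v != 0.
Proof.
rewrite (PHP n_ge3 a_neq0 a_neq1); split=> [[w w0]|v0]; last by exists v.
move=> /(point_eqP n_ge3 a_neq0 a_neq1)[c _ we].
by apply: contra_neq w0 => vE; rewrite we vE scaler0.
Qed.

End BraidAction.

Theorem proposition2p3p2 (R : realType) (n : nat) (a : R[i])
    (hn : (3 <= n)%N) (ha0 : a != 0) (ha1 : a != 1) :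
  let PHlam := PH (@lam_ends R[i] n a) in
  [/\ ([set X | PHlam X /\ pb_fixed X] #= `I_(n - 2))%card,
      forall X, PHlam X -> ~ pb_fixed X ->
        (finite_set (pb_orbit X) <-> exists2 m : nat, (0 < m)%N & a ^+ m = 1)
    & forall (rho : Lambda n -> aff R[i]) (t : 'rV[R[i]]_(n - 2)),
        Hom_lin (@lam_ends R[i] n a) rho -> PHlam (conj_class rho) ->
        homog_coords (conj_class rho) t ->
        let k := #|[set j : 'I_(n - 2) | t ord0 j != 0]%SET| in
        (pb_fixed (conj_class rho) <-> k = 1%N) /\
        (forall omega : nat, omega.-primitive_root a ->
           (pb_orbit (conj_class rho) #= `I_(omega ^ (k - 1)))%card)].
Proof.
move=> PHlam; split.
- exact: card_fixed_points.
- move=> X /(PHP hn ha0 ha1)[v v0 ->] nfix.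
  apply: (finite_pb_orbitP hn ha0 ha1 v0) => k1.
  by apply: nfix; apply/(pb_fixed_supp hn ha0 ha1 v0).
- move=> rho t h ph ht; have rE := homog_coords_point hn ha0 ha1 h ht.
  (* A point of the projective space has [t] nonzero, so the support is nonempty and [k - 1] is not
     truncated. *)
  rewrite rE in ph *; have t0 := (PH_pointP hn ha0 ha1 t).1 ph.
  split; first exact: pb_fixed_supp.
  by move=> omega prim; exact: card_pb_orbit.
Qed.
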